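(* Let $(\Omega,\mathscr{F},\mu)$ be a complete probability space and let $K\subset L^{0}(\mu)$ be absolutely convex, closed in probability and bounded in probability. Let $E_K=\mathrm{span}(K)$ and let $\varphi:E_K\to(-\infty,\infty]$ be a convex and proper function. Then for any equicontinuous Köthe topology $\tau$ on $E_K$ the following are equivalent: (1) $\{\varphi\leq\lambda\}\cap\varepsilon K$ is $\tau$-closed for every $\lambda\in\mathbb{R}$ and every $\varepsilon>0$; (2) $\varphi$ has the equicontinuous Fatou property. If, furthermore, $\tau$ has the Krein-Šmulian property, then (1) and (2) are also equivalent to lower semicontinuity of $\varphi$ with respect to $\tau$.
   Context: $L^{0}(\mu)$ carries the topology of convergence in probability. The polar of $C\subset L^{0}(\mu)$ is $C^{\circ}=\{g\in L^{0}(\mu):\sup_{f\in C}\int_\Omega|fg|\,d\mu\leq1\}$; set $E'_K=\mathrm{span}(K^{\circ})$, paired with $E_K$ via $\langle f,g\rangle=\int_\Omega fg\,d\mu$. For $F\subset E'_K$, $\sigma(E_K,F)$ is the weak topology on $E_K$ induced by this pairing. A subset $A\subset E_K$ (or a sequence) is $K$-bounded if $A\subset\lambda K$ for some $\lambda>0$. A convex proper $\varphi:E_K\to(-\infty,\infty]$ has the equicontinuous Fatou property if every $K$-bounded sequence $(f_n)$ converging in probability to $f\in E_K$ satisfies $\varphi(f)\leq\liminf_n\varphi(f_n)$. A topology $\tau$ on $E_K$ is an equicontinuous Köthe topology if $K$ is $\tau$-compact and $\tau$ restricted to $K$-bounded sets equals $\sigma(E_K,F)$ for some $F\subset E'_K$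 that is solid (in $L^0(\mu)$), separates the points of $E_K$, and contains a strictly positive element; $F$ is then said to induce $\tau$. Such $\tau$ has the Krein-Šmulian property if a convex set $C\subset E_K$ is $\tau$-closed if and only if $C\cap\lambda K$ is $\tau$-closed for each $\lambda>0$. *)

(* Defs.v *)
From HB Require Import structures.
From mathcomp Require Import all_boot all_order all_algebra.
From mathcomp Require Import all_classical all_reals all_analysis.
Set Implicit Arguments. Unset Strict Implicit. Unset Printing Implicit Defensive.
Import Order.TTheory GRing.Theory Num.Theory.
Local Open Scope classical_set_scope.
Local Open Scope ring_scope.

(* Elements of L^0(mu) are represented by measurable functions T -> R;
   subsets of L^0(mu) by sets of such functions that are saturated under
   mu-a.e. equality. *)

Definition L0 d (T : measurableType d) (R : realType) : set (T -> R) :=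
  [set f | measurable_fun setT f].
Arguments L0 {d} T R.

Definition aeeq d (T : measurableType d) (R : realType)
  (mu : probability T R) (f g : T -> R) : Prop :=
  {ae mu, forall x, f x = g x}.

Definition L0set d (T : measurableType d) (R : realType)
  (mu : probability T R) (C : set (T -> R)) : Prop :=
  C `<=` L0 T R /\
  forall f g, C f -> measurable_fun setT g -> aeeq mu f g -> C g.

Definition cvg_prob d (T : measurableType d) (R : realType)
  (mu : probability T R) (fs : nat -> T -> R) (f : T -> R) : Prop :=
  forall e : R, 0 < e ->
    (fun n => mu [set x | e <= `|fs n x - f x|]) @ \oo --> 0%E.

(* closed for the (metrizable) topology of convergence in probability *)
Definition closed_in_prob d (T : measurableType d) (R : realType)
  (mu : probability T R) (C : set (T -> R)) : Prop :=
  forall (fs : nat -> T -> R) (f : T -> R),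
    (forall n, C (fs n)) -> L0 T R f -> cvg_prob mu fs f -> C f.

Definition bounded_in_prob d (T : measurableType d) (R : realType)
  (mu : probability T R) (C : set (T -> R)) : Prop :=
  forall e : R, 0 < e -> exists M : R,
    forall f, C f -> (mu [set x | (M < `|f x|)%R] <= e%:E)%E.

Definition absolutely_convex (T : Type) (R : realType) (C : set (T -> R)) : Prop :=
  forall f g (a b : R), C f -> C g -> `|a| + `|b| <= 1 ->
    C (fun x => a * f x + b * g x).

Definition span0 d (T : measurableType d) (R : realType)
  (mu : probability T R) (C : set (T -> R)) : set (T -> R) :=
  [set h | L0 T R h /\ exists (n : nat) (c : 'I_n -> R) (fs : 'I_n -> T -> R),
     (forall i, C (fs i)) /\
     aeeq mu h (fun x => \sum_(i < n) c i * fs i x)].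

Definition scaleset (T : Type) (R : realType) (l : R) (C : set (T -> R)) :
  set (T -> R) := [set fun x => l * f x | f in C].

Definition polar d (T : measurableType d) (R : realType)
  (mu : probability T R) (C : set (T -> R)) : set (T -> R) :=
  [set g | L0 T R g /\
     forall f, C f -> (\int[mu]_x (`|f x * g x|)%:E <= 1)%E].

Definition EK d (T : measurableType d) (R : realType)
  (mu : probability T R) (K : set (T -> R)) := span0 mu K.

Definition EK' d (T : measurableType d) (R : realType)
  (mu : probability T R) (K : set (T -> R)) := span0 mu (polar mu K).

Definition pairing d (T : measurableType d) (R : realType)
  (mu : probability T R) (f g : T -> R) : R :=
  \int[mu]_x (f x * g x).

Definition K_bounded (T : Type) (R : realType) (K A : set (T -> R)) : Prop :=
  exists l : R, 0 < l /\ A `<=` scaleset l K.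

(* A topology on a subset E of functions, given by its family of open sets,
   compatible with a.e. equality (so that it is a topology on classes). *)
Definition is_topology_on d (T : measurableType d) (R : realType)
  (mu : probability T R) (E : set (T -> R)) (tau : set (set (T -> R))) : Prop :=
  [/\ (forall U, tau U -> U `<=` E),
      tau E /\ tau set0,
      (forall (I : Type) (U : I -> set (T -> R)),
          (forall i, tau (U i)) -> tau (\bigcup_i U i)),
      (forall U V, tau U -> tau V -> tau (U `&` V)) &
      (forall U f g, tau U -> U f -> E g -> aeeq mu f g -> U g)].

Definition weak_top d (T : measurableType d) (R : realType)
  (mu : probability T R) (K F : set (T -> R)) : set (set (T -> R)) :=
  [set U | U `<=` EK mu K /\
     forall f, U f -> exists (n : nat) (gs : 'I_n -> T -> R) (e : R),
       (forall i, F (gs i)) /\ 0 < e /\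
       [set h | EK mu K h /\ forall i,
           `|pairing mu h (gs i) - pairing mu f (gs i)| < e] `<=` U].

Definition trace_top (T : Type) (tau : set (set T)) (A : set T) : set (set T) :=
  [set U `&` A | U in tau].

Definition compact_in (T : Type) (tau : set (set T)) (A : set T) : Prop :=
  forall (I : Type) (U : I -> set T),
    (forall i, tau (U i)) -> A `<=` \bigcup_i U i ->
    exists J : set I, finite_set J /\ A `<=` \bigcup_(i in J) U i.

Definition tau_closed (T : Type) (E : set T) (tau : set (set T)) (C : set T) :
  Prop := C `<=` E /\ tau (E `\` C).

Definition solid d (T : measurableType d) (R : realType)
  (mu : probability T R) (F : set (T -> R)) : Prop :=
  forall g h, F g -> L0 T R h -> {ae mu, forall x, `|h x| <= `|g x|} -> F h.

Definition separates_points d (T : measurableType d) (R : realType)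
  (mu : probability T R) (F E : set (T -> R)) : Prop :=
  forall f1 f2, E f1 -> E f2 -> ~ aeeq mu f1 f2 ->
    exists g, F g /\ pairing mu f1 g <> pairing mu f2 g.

Definition has_strictly_positive d (T : measurableType d) (R : realType)
  (mu : probability T R) (F : set (T -> R)) : Prop :=
  exists g, F g /\ {ae mu, forall x, 0 < g x}.

Definition induces_top d (T : measurableType d) (R : realType)
  (mu : probability T R) (K F : set (T -> R)) (tau : set (set (T -> R))) : Prop :=
  [/\ F `<=` EK' mu K, solid mu F, separates_points mu F (EK mu K),
      has_strictly_positive mu F &
      forall A, K_bounded K A -> trace_top tau A = trace_top (weak_top mu K F) A].

Definition equicontinuous_Kothe d (T : measurableType d) (R : realType)
  (mu : probability T R) (K : set (T -> R)) (tau : set (set (T -> R))) : Prop :=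
  [/\ is_topology_on mu (EK mu K) tau, compact_in tau K &
      exists F, induces_top mu K F tau].

Definition convex_set (T : Type) (R : realType) (C : set (T -> R)) : Prop :=
  forall f g (t : R), C f -> C g -> 0 <= t <= 1 ->
    C (fun x => t * f x + (1 - t) * g x).

Definition Krein_Smulian d (T : measurableType d) (R : realType)
  (mu : probability T R) (K : set (T -> R)) (tau : set (set (T -> R))) : Prop :=
  forall C, C `<=` EK mu K -> L0set mu C -> convex_set C ->
    (tau_closed (EK mu K) tau C <->
     forall l : R, 0 < l -> tau_closed (EK mu K) tau (C `&` scaleset l K)).

Definition convex_proper d (T : measurableType d) (R : realType)
  (mu : probability T R) (E : set (T -> R)) (phi : (T -> R) -> \bar R) : Prop :=
  [/\ (forall f g, E f -> E g -> aeeq mu f g -> phi f = phi g),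
      (forall f, E f -> phi f != -oo%E),
      (exists f, E f /\ (phi f < +oo)%E) &
      (forall f g (t : R), E f -> E g -> 0 <= t <= 1 ->
         (phi (fun x => (t * f x + (1 - t) * g x)%R)
            <= t%:E * phi f + (1 - t)%:E * phi g)%E)].

Definition sublevel (T : Type) (R : realType) (E : set T) (phi : T -> \bar R)
  (l : R) : set T := [set f | E f /\ (phi f <= l%:E)%E].

Definition equicontinuous_Fatou d (T : measurableType d) (R : realType)
  (mu : probability T R) (K : set (T -> R)) (phi : (T -> R) -> \bar R) : Prop :=
  forall (fs : nat -> T -> R) (f : T -> R),
    K_bounded K (range fs) -> EK mu K f -> cvg_prob mu fs f ->
    (phi f <= limn_einf (fun n => phi (fs n)))%E.

Definition lsc_on (T : Type) (R : realType) (E : set T) (tau : set (set T))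
  (phi : T -> \bar R) : Prop :=
  forall f (r : R), E f -> (r%:E < phi f)%E ->
    exists U, [/\ tau U, U f & forall h, U h -> (r%:E < phi h)%E].

(* Main.v *)
(* (2) -> (1).  Let w in F with 0 < w <= 1.  A convex set C in eK that is
   closed in probability contains a minimiser p of
   J(c) = int psi(f - c) w dmu, psi(a) = sqrt(1 + a^2): psi' is bounded and the
   convexity gap of psi controls the increments of psi', so psi'(f - c_n)
   converges a.e. along a minimising sequence, and Fatou's lemma keeps the
   limit of c_n finite.  The first-order condition at p says that
   psi'(f - p) w, which lies in F by solidity, strictly separates f from C.
   Hence C is sigma(E_K, F)-closed in every lK, and this makes it tau-closed.

   (1) -> (2).  Given f_n -> f in probability in lK with phi(f_n) <= r, pass to
   an a.e. convergent subsequence.  By tau-compactness it has a cluster point,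
   and testing against one suitable element of F, small enough to allow
   dominated convergence, identifies this cluster point with f a.e. *)
Require Import Defs.
From HB Require Import structures.
From mathcomp Require Import all_boot all_order all_algebra.
From mathcomp Require Import all_classical all_reals all_analysis.
From mathcomp Require Import measurable_realfun ring lra.
Import Order.TTheory GRing.Theory Num.Theory.
Import numFieldNormedType.Exports.
Set Implicit Arguments. Unset Strict Implicit. Unset Printing Implicit Defensive.
Local Open Scope classical_set_scope.
Local Open Scope ring_scope.

(** * The strictly convex integrand *)

Section psi.
Context {R : realType}.
Implicit Types a b : R.

Definition psi a : R := Num.sqrt (1 + a ^+ 2).
(** The derivative of [psi], used through its formula: the inequalities and the continuity below
    stand in for any differentiation. *)
Definition dpsi a : R := a / psi a.

Lemma psi_sqr a : psi a ^+ 2 = 1 + a ^+ 2.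
Proof. by rewrite sqr_sqrtr // addr_ge0 ?sqr_ge0. Qed.

Lemma psi_ge0 a : 0 <= psi a. Proof. exact: sqrtr_ge0. Qed.

Lemma psi_ge1 a : 1 <= psi a.
Proof.
by rewrite -sqrtr1; apply: ler_wsqrtr; rewrite lerDl sqr_ge0.
Qed.

Lemma psi_gt0 a : 0 < psi a. Proof. exact: lt_le_trans (psi_ge1 a). Qed.

Lemma psi_le a : psi a <= 1 + `|a|.
Proof.
rewrite -(@ler_pXn2r _ 2) ?nnegrE ?psi_ge0 ?addr_ge0 //.
by rewrite psi_sqr sqrrD expr1n real_normK ?num_real // lerD2r lerDl mul1r mulrn_wge0.
Qed.

Lemma dpsi_psi a : dpsi a * psi a = a.
Proof. by rewrite divfK // gt_eqF // psi_gt0. Qed.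

Lemma dpsi_sqr a : 1 - dpsi a ^+ 2 = ((psi a)^-1) ^+ 2.
Proof.
have p0 := psi_gt0 a; have := psi_sqr a.
rewrite /dpsi => H; rewrite expr_div_n exprVn H; field.
by apply: lt0r_neq0; rewrite -H exprn_gt0.
Qed.

Lemma dpsi_le1 a : `|dpsi a| <= 1.
Proof.
rewrite -(@ler_pXn2r _ 2) ?nnegrE // real_normK ?num_real // expr1n.
by rewrite -subr_ge0 dpsi_sqr sqr_ge0.
Qed.

(** Cauchy-Schwarz for the vectors (1, a) and (1, b): the two squares differ by (a - b)^2. *)
Lemma psi_CS a b : `|1 + a * b| <= psi a * psi b.
Proof.
rewrite -(@ler_pXn2r _ 2) ?nnegrE ?mulr_ge0 ?psi_ge0 //.
rewrite real_normK ?num_real // exprMn !psi_sqr -subr_ge0.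
rewrite [X in 0 <= X](_ : _ = (a - b) ^+ 2); last by ring.
exact: sqr_ge0.
Qed.

(** Multiplied by [psi b], the left side becomes 1 + ab, so this is Cauchy-Schwarz again. *)
Lemma psi_subgradient a b : psi b + dpsi b * (a - b) <= psi a.
Proof.
have p0 := psi_gt0 b.
rewrite -(ler_pM2r p0) mulrDl mulrAC dpsi_psi -expr2 psi_sqr.
have := psi_CS a b; have := ler_norm (1 + a * b); nra.
Qed.

(* With u = (1, a) and v = (1, b), psi is the Euclidean norm and dpsi the second
   coordinate of the normalised vector; the gap is |u| + |v| - |u + v|. *)
Lemma psi_gap a b : (dpsi a - dpsi b) ^+ 2 <=
  4 * (psi a + psi b - 2 * psi ((a + b) / 2)).
Proof.
set P := psi a; set Q := psi b; set M := 2 * psi _.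
have P1 : 1 <= P := psi_ge1 a.
have Q1 : 1 <= Q := psi_ge1 b.
have M1 : 0 <= M by rewrite mulr_ge0 ?psi_ge0.
have HP : P ^+ 2 = 1 + a ^+ 2 := psi_sqr a.
have HQ : Q ^+ 2 = 1 + b ^+ 2 := psi_sqr b.
have HM : M ^+ 2 = 4 + (a + b) ^+ 2.
  by rewrite exprMn psi_sqr; field.
(* [D] is the deficit in Cauchy-Schwarz. The gap P + Q - M and [D] are linked by the difference of
   squares [HD]. *)
pose D := P * Q - (1 + a * b).
have D0 : 0 <= D.
  by rewrite subr_ge0 (le_trans (ler_norm _))// psi_CS.
have HD : (P + Q - M) * (P + Q + M) = 2 * D.
  rewrite /D [LHS](_ : _ = P^+2 + Q ^+2 + 2 * (P * Q) - M ^+2); last by ring.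
  by rewrite HP HQ HM; ring.
have MPQ : M <= P + Q.
  rewrite -subr_ge0 -(@pmulr_lge0 _ (P + Q + M)) ?HD; last by lra.
  by rewrite mulr_ge0.
have PQ0 : 0 < P * Q by nra.
(* Times PQ, the squared increment of [dpsi] equals 2D - (P - Q)^2 / (PQ), whence this intermediate
   bound. *)
apply: (@le_trans _ _ (2 * D / (P * Q))).
  rewrite ler_pdivlMr // /dpsi -/P -/Q.
  have -> : (a / P - b / Q) ^+ 2 * (P * Q) =
     2 * D - (P - Q) ^+ 2 / (P * Q).
    have -> : a / P - b / Q = (a * Q - b * P) / (P * Q).
      field; apply/andP; split; apply: lt0r_neq0; lra.
    rewrite expr_div_n (expr2 (P * Q)).
    have -> : (a * Q - b * P) ^+ 2 = 2 * D * (P * Q) - (P - Q) ^+ 2.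
      have -> : (a * Q - b * P) ^+ 2 =
        a ^+ 2 * Q ^+ 2 + b ^+ 2 * P ^+ 2 - 2 * (a * b) * (P * Q) by ring.
      have -> : a ^+ 2 = P ^+ 2 - 1 by lra.
      have -> : b ^+ 2 = Q ^+ 2 - 1 by lra.
      rewrite /D; ring.
    field; apply/andP; split; apply: lt0r_neq0; lra.
  by rewrite gerBl divr_ge0 ?sqr_ge0 // ltW.
(* By [HD] and M <= P + Q, 2D is at most twice the gap times P + Q; moreover P + Q <= 2PQ because P
   and Q are at least 1. *)
rewrite ler_pdivrMr //.
have E0 : 0 <= P + Q - M by lra.
apply: (@le_trans _ _ (2 * ((P + Q - M) * (P + Q)))).
  rewrite -HD; nra.
have : P + Q <= 2 * (P * Q) by nra.
nra.
Qed.

Lemma continuous_psi : continuous psi.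
Proof.
move=> a; apply: continuous_comp; last exact: sqrt_continuous.
apply: cvgD; [exact: cvg_cst|exact: exprn_continuous].
Qed.

Lemma continuous_dpsi : continuous dpsi.
Proof.
move=> a; apply: cvgM; first exact: cvg_id.
apply: cvgV; first by rewrite gt_eqF // psi_gt0.
exact: continuous_psi.
Qed.

(* dpsi maps R onto (-1, 1), so the second hypothesis only excludes that the
   sequence escapes to infinity. *)
Lemma cvg_of_dpsi (a_ : R^nat) (s : R) (B : R) :
  dpsi \o a_ @ \oo --> s ->
  (forall n, exists2 m, (n <= m)%N & psi (a_ m) < B) ->
  cvgn a_.
Proof.
move=> as_ aB.
have q_ : (fun n => ((psi (a_ n))^-1) ^+ 2) @ \oo --> 1 - s ^+ 2.
  under eq_fun do rewrite -dpsi_sqr.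
  apply: cvgB; first exact: cvg_cst.
  by under eq_fun do rewrite expr2; apply: cvgM.
have B0 : 0 < B by have [m _] := aB 0%N; apply: lt_trans; exact: psi_gt0.
(* Otherwise [psi (a_ n)]^-2 would eventually stay below B^-2, against [psi (a_ m) < B] for
   arbitrarily late m. *)
have L0 : 0 < 1 - s ^+ 2.
  rewrite ltNge; apply/negP => L0.
  have e0 : 0 < B^-1 ^+ 2 by rewrite exprn_gt0 ?invr_gt0.
  have [N _ HN] : \forall n \near \oo, ((psi (a_ n))^-1) ^+ 2 < B^-1 ^+ 2.
    by apply: (cvgr_lt _ q_); apply: le_lt_trans e0.
  have [m Nm] := aB N.
  have := HN m Nm; rewrite /= ltNge => /negP + mB; apply.
  rewrite ler_pXn2r ?nnegrE ?invr_ge0 ?psi_ge0 ?ltW //.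
  by rewrite ltf_pV2 ?posrE ?psi_gt0.
have p_ : (fun n => psi (a_ n)) @ \oo --> (Num.sqrt (1 - s ^+ 2))^-1.
  have -> : (fun n => psi (a_ n)) = (fun n => (Num.sqrt (((psi (a_ n))^-1) ^+ 2))^-1).
    apply/funext => n; rewrite sqrtr_sqr ger0_norm ?invr_ge0 ?psi_ge0 //.
    by rewrite invrK.
  apply: cvgV; first by rewrite gt_eqF // sqrtr_gt0.
  by apply: continuous_cvg => //; exact: sqrt_continuous.
apply/cvg_ex; exists (s * (Num.sqrt (1 - s ^+ 2))^-1).
have -> : a_ = (fun n => dpsi (a_ n) * psi (a_ n)).
  by apply/funext => n; rewrite dpsi_psi.
exact: cvgM.
Qed.

End psi.

(** * Almost everywhere convergence and integration *)

Lemma limn_einf_lt_frequently (R : realType) (u : (\bar R)^nat) (b : \bar R) :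
  (limn_einf u < b)%E -> forall n, exists2 m, (n <= m)%N & (u m < b)%E.
Proof.
move=> ub n; have : (einfs u n < b)%E.
  apply: le_lt_trans ub; rewrite limn_einf_lim (cvg_lim _ (@cvg_einfs_sup _ u)) //.
  by apply: ereal_sup_ubound; exists n.
by move=> /ereal_inf_lt [_ [m nm <-] um]; exists m.
Qed.

Lemma cvgn_geometric_increments (R : realType) (u : R^nat) (M : R) :
  (forall n, `|u n.+1 - u n| <= M * 2^-1 ^+ n) -> cvgn u.
Proof.
move=> uM.
have : cvgn (series (fun n => u n.+1 - u n)).
  apply: normed_cvg.
  apply: (@series_le_cvg _ _ (geometric M 2^-1)) => [n|n|n|].
  - exact: normr_ge0.
  - exact: (le_trans (normr_ge0 _) (uM n)).
  - exact: uM.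
  by apply: is_cvg_geometric_series; rewrite ger0_norm ?invf_lt1 ?ltr1n ?invr_ge0.
have -> : series (fun n => u n.+1 - u n) = (fun n => u n - u 0%N).
  by apply/funext => n; rewrite /series /= telescope_sumr.
move=> /cvg_ex [l ul]; apply/cvg_ex; exists (l + u 0%N).
have uE : (fun n => (u n - u 0%N) + u 0%N) = u.
  by apply/funext => n; rewrite subrK.
have : (fun n => (u n - u 0%N) + u 0%N) @ \oo --> l + u 0%N.
  by apply: cvgD => //; exact: cvg_cst.
by rewrite uE.
Qed.

Section ae.
Context d (T : measurableType d) (R : realType) (mu : probability T R).

(** The sum of the [h n] has a finite integral, hence is a.e. finite, and it dominates each term. *)
Lemma ae_bounded_of_integral_le (h : nat -> T -> R) :
  (forall n, measurable_fun setT (h n)) -> (forall n x, 0 <= h n x) ->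
  (forall n, (\int[mu]_x (h n x)%:E <= (2^-1 ^+ n)%:E)%E) ->
  {ae mu, forall x, exists M, forall n, h n x <= M}.
Proof.
move=> mh h0 hle.
pose S x := (\sum_(n <oo) (h n x)%:E)%E.
have mh' n : measurable_fun setT (EFin \o h n) by apply/measurable_EFinP.
have S0 x : (0 <= S x)%E by apply: nneseries_ge0 => n _ _; rewrite lee_fin.
have mS : measurable_fun setT S.
  apply: ge0_emeasurable_sum => //.
  - by move=> k x _ _; rewrite lee_fin.
  - by move=> k _; exact: mh'.
have iS : mu.-integrable setT S.
  apply/integrableP; split => //.
  under eq_integral do rewrite gee0_abs //.
  rewrite integral_nneseries //; last by move=> n x _; rewrite lee_fin.
  apply: (@le_lt_trans _ _ (\sum_(n <oo) (2^-1 ^+ n)%:E)%E).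
    apply: lee_nneseries => //.
    by move=> n _ _; apply: integral_ge0 => x _; rewrite lee_fin.
  have -> : (\sum_(n <oo) (2^-1 ^+ n)%:E)%E = (limn (series (geometric 1 2^-1 : R^nat)))%:E.
    rewrite -EFin_lim; last first.
      by apply: is_cvg_geometric_series; rewrite ger0_norm ?invf_lt1 ?ltr1n ?invr_ge0.
    congr (limn _); apply/funext => n; rewrite /= /series /= sumEFin.
    by congr (_%:E); apply: eq_bigr => i _; rewrite mul1r.
  by rewrite ltry.
have := integrable_ae measurableT iS.
apply: filterS => x /(_ I) /fin_numP [_ Sx].
exists (fine (S x)) => n; rewrite -lee_fin fineK; last first.
  by rewrite ge0_fin_numE // ltey; apply/eqP/eqP; exact: Sx.
have : (\sum_(0 <= k < n.+1) (h k x)%:E <= S x)%E.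
  by apply: nneseries_lim_ge => k _ _; rewrite lee_fin.
apply: le_trans; rewrite big_nat_recr //= leeDr // sume_ge0 // => k _.
by rewrite lee_fin.
Qed.

Lemma measurable_distance_ge (u v : T -> R) (e : R) :
  measurable_fun setT u -> measurable_fun setT v ->
  measurable [set x | e <= `|u x - v x|].
Proof.
move=> mu_ mv.
have mf : measurable_fun setT (fun x => `|u x - v x|).
  by apply: measurableT_comp => //; exact: measurable_funB.
rewrite -[X in measurable X]setTI.
have -> : [set x | e <= `|u x - v x|] = (fun x => `|u x - v x|) @^-1` `[e, +oo[.
  by apply/seteqP; split => x /=; rewrite in_itv/= andbT.
exact: mf.
Qed.

(** The limit superior of the events where [v n] is at distance at least e from f misses every point
    of convergence, so it is null. It is the limit in measure of the tail unions, which contain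
    these events. *)
Lemma ae_cvg_cvg_prob (v : nat -> T -> R) (f : T -> R) :
  (forall n, measurable_fun setT (v n)) -> measurable_fun setT f ->
  {ae mu, forall x, v ^~ x @ \oo --> f x} -> cvg_prob mu v f.
Proof.
move=> mv mf vf e e0.
pose F n := [set x | e <= `|v n x - f x|].
have mF n : measurable (F n) by exact: measurable_distance_ge.
have mL : measurable (lim_sup_set F).
  apply: bigcap_measurable => // k _.
  by apply: bigcup_measurable => j /= _; exact: mF.
have L0 : mu (lim_sup_set F) = 0%E.
  apply: measure_negligible => //.
  apply: negligibleS vf => x /= Lx vx.
  have /cvgrPdist_lt /(_ _ e0) [N _ HN] := vx.
  have [j /= Nj Fj] := Lx N I.
  by have := HN j Nj; rewrite /= distrC ltNge Fj.
have cvgU : mu (\bigcup_(k >= n) F k) @[n --> \oo] --> 0%E.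
  rewrite -L0; apply: lim_sup_set_cvg => //.
  apply: le_lt_trans (ltry 1).
  by apply: probability_le1; apply: bigcup_measurable => j /= _; exact: mF.
apply: (@squeeze_cvge _ _ _ _ (cst 0%E) _ (fun n => mu (\bigcup_(k >= n) F k))).
- apply: nearW => n; rewrite measure_ge0 /= le_measure ?inE //.
  + exact: mF.
  + by apply: bigcup_measurable => j /= _; exact: mF.
  + by move=> x Fx; exists n => /=.
- exact: cvg_cst.
- exact: cvgU.
Qed.

(** [P] is a property that holds at arbitrarily late indices and is to be kept by the chosen terms.
    [k] need not be increasing: convergence comes from the bounds 2^-n on the distances alone. *)
Lemma cvg_prob_fast_subseq (P : set (T -> R)) (v : nat -> T -> R) (f : T -> R) :
  (forall n, measurable_fun setT (v n)) -> measurable_fun setT f ->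
  cvg_prob mu v f -> (forall n, exists2 m, (n <= m)%N & P (v m)) ->
  exists k : nat -> nat, (forall n, P (v (k n))) /\
    {ae mu, forall x, (fun n => v (k n) x) @ \oo --> f x}.
Proof.
move=> mv mf vf Pv.
have kE n : exists m, P (v m) /\
    (mu [set x | (2^-1 ^+ n <= `|v m x - f x|)%R] <= (4^-1 ^+ n)%:E)%E.
  have e0 : 0 < 2^-1 ^+ n :> R by rewrite exprn_gt0.
  have d0 : (0 < (4^-1 ^+ n)%:E :> \bar R)%E by rewrite lte_fin exprn_gt0.
  have [N _ HN] := vf _ e0 _ (open_ereal_lt' d0).
  by have [m Nm Pm] := Pv N; exists m; split => //; apply: ltW; exact: HN.
have {kE}[k kP] := choice kE.
exists k; split; first by move=> n; have [] := kP n.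
pose A n := [set x | 2^-1 ^+ n <= `|v (k n) x - f x|].
have mA n : measurable (A n) by exact: measurable_distance_ge.
(* The weighted indicator has integral at most 2^n 4^-n = 2^-n. Where all of them are bounded by
   some M, the point x leaves [A n] as soon as 2^n > M. *)
have h0 n x : 0 <= 2 ^+ n * \1_(A n) x :> R by rewrite mulr_ge0.
have mh n : measurable_fun setT (fun x => 2 ^+ n * \1_(A n) x : R).
  by apply: measurable_funM => //; exact: measurable_indic.
have := ae_bounded_of_integral_le mh h0.
case=> // [n|N [mN N0 NH]].
  under eq_integral do rewrite EFinM.
  rewrite ge0_integralZl_EFin //; last by apply/measurable_EFinP; exact: measurable_indic.
  rewrite integral_indic // setIT.
  have [_ muA] := kP n.
  apply: (@le_trans _ _ ((2 ^+ n)%:E * (4^-1 ^+ n)%:E)%E).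
    by rewrite lee_wpmul2l // lee_fin.
  rewrite -EFinM lee_fin -exprMn.
  by have -> : (2 * 4^-1 : R) = 2^-1 by field.
exists N; split => // x; apply: contra_notP => nNx; move: (contra_not (@NH x) nNx).
move=> /contrapT [M HM].
have [m Mm] : exists m, M < 2 ^+ m :> R.
  exists (Num.bound `|M|); apply: le_lt_trans (ler_norm M) _.
  apply: (lt_trans (archi_boundP (normr_ge0 M))).
  by rewrite -natrX ltr_nat ltn_expl.
have small n : (m <= n)%N -> `|f x - v (k n) x| < 2^-1 ^+ n.
  move=> mn; rewrite distrC ltNge; apply/negP => Ax.
  have := HM n; rewrite indicE mem_set //= mulr1 leNgt => /negP; apply.
  by apply: lt_le_trans Mm _; rewrite ler_weXn2l // ler1n.
apply/cvgrPdist_lt => e e0.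
have : (2^-1 ^+ n : R) @[n --> \oo] --> (0 : R).
  by apply: cvg_expr; rewrite ger0_norm ?invf_lt1 ?ltr1n ?invr_ge0.
move=> /cvgrPdist_lt /(_ _ e0) [N1 _ HN1].
exists (maxn m N1) => // n /=; rewrite geq_max => /andP[mn Nn].
apply: lt_trans (small n mn) _.
by have := HN1 n Nn; rewrite /= sub0r normrN ger0_norm // exprn_ge0 // invr_ge0.
Qed.
End ae.

Section integration.
Context d (T : measurableType d) (R : realType) (mu : probability T R).

Lemma dominated_integrable (g h : T -> R) :
  measurable_fun setT g -> (forall x, `|g x| <= h x) ->
  mu.-integrable setT (EFin \o h) -> mu.-integrable setT (EFin \o g).
Proof.
move=> mg gh; apply: le_integrable => //; first exact/measurable_EFinP.
by move=> x _; rewrite /= lee_fin (le_trans (gh x)) // ler_norm.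
Qed.

Lemma integrable_EFinD (g h : T -> R) :
  mu.-integrable setT (EFin \o g) -> mu.-integrable setT (EFin \o h) ->
  mu.-integrable setT (EFin \o (fun x => g x + h x)).
Proof. by move=> ig ih; exact: (integrableD measurableT ig ih). Qed.

Lemma integrable_EFinZ (k : R) (g : T -> R) :
  mu.-integrable setT (EFin \o g) ->
  mu.-integrable setT (EFin \o (fun x => k * g x)).
Proof. by move=> ig; exact: (integrableZl measurableT k ig). Qed.

Lemma integrable_EFinB (g h : T -> R) :
  mu.-integrable setT (EFin \o g) -> mu.-integrable setT (EFin \o h) ->
  mu.-integrable setT (EFin \o (fun x => g x - h x)).
Proof. by move=> ig ih; exact: (integrableB measurableT ig ih). Qed.

Lemma Rintegral_dominated_cvg (g_ : nat -> T -> R) (g h : T -> R) :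
  (forall n, measurable_fun setT (g_ n)) -> measurable_fun setT g ->
  {ae mu, forall x, g_ ^~ x @ \oo --> g x} ->
  mu.-integrable setT (EFin \o h) ->
  {ae mu, forall x n, `|g_ n x| <= h x} ->
  (fun n => \int[mu]_x g_ n x) @ \oo --> \int[mu]_x g x.
Proof.
move=> mg_ mg gg ih gh.
have [] := @dominated_convergence _ _ _ mu setT measurableT
  (fun n => EFin \o g_ n) (EFin \o g) (EFin \o h) _ _ _ _ _ => //.
- by move=> n; exact/measurable_EFinP.
- exact/measurable_EFinP.
- apply: filterS gg => x gx _; apply: cvg_EFin; first exact: nearW.
  exact: gx.
- by apply: filterS gh => x + n _; rewrite /= lee_fin; exact.
- move=> ig _ cg; apply: fine_cvg; rewrite fineK //.
  exact: integrable_fin_num.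
Qed.

Lemma ae_eq_of_integral0 (g : T -> R) :
  (forall x, 0 <= g x) -> mu.-integrable setT (EFin \o g) ->
  \int[mu]_x g x = 0 -> {ae mu, forall x, g x = 0}.
Proof.
move=> g0 ig gE.
have : (\int[mu]_x `|(EFin \o g) x|)%E = 0%E.
  under eq_integral do rewrite gee0_abs ?lee_fin //.
  rewrite -[LHS]fineK; last exact: integrable_fin_num ig.
  by rewrite -[X in X%:E]/(\int[mu]_x g x) gE.
move=> /(ae_eq_integral_abs mu measurableT) H.
have {}H := H _.
have : measurable_fun setT (EFin \o g) by case/integrableP: ig.
by move=> /H; apply: filterS => x /(_ I) [].
Qed.

End integration.

(** * Separation of a point from a convex set closed in probability *)

(* [convex_set] is qualified because MathComp-Analysis has another one. *)
Section separation.
Context d (T : measurableType d) (R : realType) (mu : probability T R).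

Variables (w f : T -> R) (C : set (T -> R)).
Hypotheses (mw : measurable_fun setT w) (w01 : forall x, 0 <= w x <= 1)
  (wpos : {ae mu, forall x, 0 < w x})
  (mf : measurable_fun setT f) (fw : mu.-integrable setT (EFin \o (f \* w)))
  (mC : C `<=` L0 T R) (convC : Defs.convex_set C) (closedC : closed_in_prob mu C)
  (Cw : forall c, C c -> mu.-integrable setT (EFin \o (c \* w)))
  (C0 : C !=set0).

Let J c := \int[mu]_x (psi (f x - c x) * w x).

Let iw : mu.-integrable setT (EFin \o w).
Proof.
apply: (@dominated_integrable _ _ _ _ _ (cst 1)) => //.
  by move=> x; have /andP[? ?] := w01 x; rewrite ger0_norm.
exact: finite_measure_integrable_cst.
Qed.

Let measurable_psi (g : T -> R) : measurable_fun setT g ->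
  measurable_fun setT (fun x : T => psi (g x)).
Proof.
move=> mg; apply: (@measurableT_comp _ _ _ _ _ _ psi) => //.
apply: continuous_measurable_fun; exact: continuous_psi.
Qed.

Let measurable_dpsi (g : T -> R) : measurable_fun setT g ->
  measurable_fun setT (fun x : T => dpsi (g x)).
Proof.
move=> mg; apply: (@measurableT_comp _ _ _ _ _ _ dpsi) => //.
apply: continuous_measurable_fun; exact: continuous_dpsi.
Qed.

Let integrable_J c : C c ->
  mu.-integrable setT (EFin \o (fun x => psi (f x - c x) * w x)).
Proof.
move=> Cc.
apply: (@dominated_integrable _ _ _ _ _ (fun x => w x + (`|f x * w x| + `|c x * w x|))).
- by apply: measurable_funM => //; apply: measurable_psi; apply: measurable_funB => //; exact: mC.
- move=> x; have /andP[w0 _] := w01 x.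
  rewrite ger0_norm ?mulr_ge0 ?psi_ge0 // !normrM (ger0_norm w0).
  have H : psi (f x - c x) <= 1 + (`|f x| + `|c x|).
    by rewrite (le_trans (psi_le _)) // lerD2l ler_normB.
  by apply: le_trans (ler_wpM2r w0 H) _; rewrite !mulrDl mul1r.
- have -> : EFin \o (fun x => w x + (`|f x * w x| + `|c x * w x|)) =
   (EFin \o w) \+ ((EFin \o (fun x => `|f x * w x|)) \+ (EFin \o (fun x => `|c x * w x|))).
     by apply/funext => x /=; rewrite !EFinD.
  apply: integrableD => //; apply: integrableD => //; first exact: (integrable_norm fw).
  exact: (integrable_norm (Cw Cc)).
Qed.

(* c_ n minimises J up to 8^-(n+1), so that the increments of dpsi (f - c_ n)
   are a.e. O(2^-n). *)
Lemma exists_psi_minimizer : exists2 p, C p & forall c, C c -> J p <= J c.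
Proof.
have J0 c : 0 <= J c.
  by apply: Rintegral_ge0 => x _; have /andP[? _] := w01 x; rewrite mulr_ge0 ?psi_ge0.
pose m := inf [set J c | c in C].
have hinf : has_inf [set J c | c in C].
  split; first by have [c Cc] := C0; exists (J c); exists c.
  by exists 0 => _ [c _ <-].
have mJ c : C c -> m <= J c.
  by move=> Cc; apply: ge_inf; [case: hinf|exists c].
have c_E n : exists c, C c /\ J c < m + 8^-1 ^+ n.+1.
  have e0 : 0 < 8^-1 ^+ n.+1 :> R by rewrite exprn_gt0.
  by have [_ [c Cc <-] Jc] := inf_adherent e0 hinf; exists c.
have {c_E}[c_ c_P] := choice c_E.
have Cc n : C (c_ n) by have [] := c_P n.
have mc n : measurable_fun setT (c_ n) by exact: mC.
pose a_ n x := f x - c_ n x.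
have ma n : measurable_fun setT (a_ n) by exact: measurable_funB.
pose h n x := 4 ^+ n * ((dpsi (a_ n x) - dpsi (a_ n.+1 x)) ^+ 2 * w x).
have mh n : measurable_fun setT (h n).
  apply: measurable_funM => //; apply: measurable_funM => //.
  by apply: measurable_funX; apply: measurable_funB; exact: measurable_dpsi.
have h0 n x : 0 <= h n x.
  by have /andP[? _] := w01 x; rewrite mulr_ge0 ?exprn_ge0 // mulr_ge0 // sqr_ge0.
(* The midpoint [c] is in C, so J c >= m and the midpoint gap of J is at most 2 * 8^-(n+1). The
   factor 4 of [psi_gap] makes this 8^-n, and the weight 4^n leaves 2^-n. *)
have ih n : (\int[mu]_x (h n x)%:E <= (2^-1 ^+ n)%:E)%E.
  pose c x := 2^-1 * c_ n x + (1 - 2^-1) * c_ n.+1 x.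
  have Cmid : C c by apply: (convC (Cc n) (Cc n.+1)); lra.
  pose G x := 4 ^+ n * (4 * ((psi (a_ n x) * w x + psi (a_ n.+1 x) * w x) -
     2 * (psi (f x - c x) * w x))).
  have hG x : h n x <= G x.
    have /andP[w0 _] := w01 x.
    rewrite /h /G ler_wpM2l ?exprn_ge0 //.
    have -> : f x - c x = (a_ n x + a_ n.+1 x) / 2 by rewrite /c /a_; field.
    rewrite mulrA -mulrDl -mulrBl mulrA ler_wpM2r //; exact: psi_gap.
  have iG : mu.-integrable setT (EFin \o G).
    do 2 apply: integrable_EFinZ; apply: integrable_EFinB.
      by apply: integrable_EFinD; exact: integrable_J.
    by apply: integrable_EFinZ; exact: integrable_J.
  have GE : \int[mu]_x G x = 4 ^+ n * (4 * ((J (c_ n) + J (c_ n.+1)) - 2 * J c)).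
    have i1 := integrable_J (Cc n); have i2 := integrable_J (Cc n.+1).
    have i3 := integrable_J Cmid; have i4 := integrable_EFinD i1 i2.
    have i5 := integrable_EFinZ 2 i3; have i6 := integrable_EFinB i4 i5.
    have i7 := integrable_EFinZ 4 i6.
    rewrite /G RintegralZl // RintegralZl // RintegralB // RintegralD // RintegralZl //.
  apply: (@le_trans _ _ (\int[mu]_x (G x)%:E)%E).
    apply: ge0_le_integral => //.
    - by move=> x _; rewrite lee_fin.
    - exact/measurable_EFinP.
    - by case/integrableP: iG.
    - by move=> x _; rewrite lee_fin.
  rewrite -[leLHS]fineK ?integrable_fin_num // lee_fin.
  rewrite -/(Rintegral mu setT G) GE.
  have [_ J1] := c_P n; have [_ J2] := c_P n.+1; have J3 := mJ _ Cmid.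
  have J4 : J (c_ n) + J (c_ n.+1) - 2 * J c <= 2 * 8^-1 ^+ n.+1.
    have : 8^-1 ^+ n.+2 <= 8^-1 ^+ n.+1 :> R by rewrite exprS ler_piMl // ?exprn_ge0 //; lra.
    lra.
  apply: (@le_trans _ _ (4 ^+ n * (4 * (2 * 8^-1 ^+ n.+1)))).
    by rewrite ler_wpM2l ?exprn_ge0 // ler_wpM2l.
  have -> : 4 * (2 * 8^-1 ^+ n.+1) = 8^-1 ^+ n :> R by rewrite exprS; field.
  by rewrite -exprMn; have -> : (4 * 8^-1 : R) = 2^-1 by field.
(* By Fatou's lemma the integral of [g] is at most m. So [g] is a.e. finite, which prevents the
   sequence [a_ n x] from escaping to infinity. *)
pose g x := limn_einf (fun n => (psi (a_ n x) * w x)%:E).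
have mpsi n : measurable_fun setT (fun x => (psi (a_ n x) * w x)%:E).
  by apply/measurable_EFinP; apply: measurable_funM => //; exact: measurable_psi.
have psi0 n x : (0 <= (psi (a_ n x) * w x)%:E)%E.
  by have /andP[? _] := w01 x; rewrite lee_fin mulr_ge0 ?psi_ge0.
have mg : measurable_fun setT g.
  apply: measurableT_comp => //; apply: measurable_fun_limn_esup => n.
  exact: measurableT_comp.
have g0 x : (0 <= g x)%E.
  rewrite /g limn_einf_lim; apply: lime_ge; first exact: is_cvg_einfs.
  by apply: nearW => n; apply: le_ereal_inf_tmp => _ [k _ <-].
have gm : (\int[mu]_x g x <= m%:E)%E.
  have := @fatou _ _ _ mu setT measurableT _ mpsi (fun n x _ => psi0 n x).
  move=> /le_trans; apply.
  have -> : (fun n => \int[mu]_x (psi (a_ n x) * w x)%:E)%E = EFin \o (J \o c_).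
    apply/funext => n; rewrite /= /J /Rintegral fineK //; apply: integrable_fin_num => //.
    exact: integrable_J.
  have -> : m%:E = limn_einf (EFin \o (J \o c_)); last by [].
  apply/esym; have [] := @cvg_limn_einf_sup _ (EFin \o (J \o c_)) m%:E => //.
  apply: cvg_EFin; first by apply: nearW.
  apply: (@squeeze_cvgr _ _ _ _ (cst m) (fun n => m + 8^-1 ^+ n.+1)).
  - by apply: nearW => n /=; rewrite mJ //= ltW //; have [] := c_P n.
  - exact: cvg_cst.
  - rewrite -[X in _ --> X]addr0; apply: cvgD; first exact: cvg_cst.
    rewrite (cvg_shiftS (fun n => 8^-1 ^+ n : R)); apply: cvg_expr.
    by rewrite ger0_norm ?invf_lt1 ?ltr1n ?invr_ge0.
have ig : mu.-integrable setT g.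
  apply/integrableP; split => //; under eq_integral do rewrite gee0_abs //.
  exact: le_lt_trans gm (ltry _).
have aeg := integrable_ae measurableT ig.
have aeh := ae_bounded_of_integral_le mh h0 ih.
have aec : {ae mu, forall x, exists2 l, c_ ^~ x @ \oo --> l & g x = (psi (f x - l) * w x)%:E}.
  apply: filterS3 aeg aeh wpos => x /(_ I) gx [M HM] wx.
  have /cvg_ex[s sE] : cvgn (fun n => dpsi (a_ n x)).
    (* The constant comes from solving [h n x <= M] for the increment of [dpsi]. *)
    apply: (@cvgn_geometric_increments _ _ (Num.sqrt (M / w x))) => n.
    rewrite -(@ler_pXn2r _ 2) ?nnegrE ?mulr_ge0 ?sqrtr_ge0 ?exprn_ge0 ?invr_ge0 //.
    have M0 : 0 <= M := le_trans (h0 0%N x) (HM 0%N).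
    rewrite real_normK ?num_real // exprMn sqr_sqrtr ?(divr_ge0 M0 (ltW wx)) //.
    rewrite -exprM mulnC exprM (_ : (2^-1 ^+ 2 : R) = 4^-1); last by field.
    rewrite exprVn ler_pdivlMr ?exprn_gt0 // ler_pdivlMr //.
    apply: le_trans (HM n); rewrite /h le_eqVlt; apply/orP; left; apply/eqP; ring.
  have [l lE] : exists l : R, a_ ^~ x @ \oo --> l.
    (* Since g x is a lower limit, [psi (a_ k x) * w x] is below g x + 1 for arbitrarily late k;
       dividing by w x gives the bound. *)
    apply/cvg_ex; apply: (@cvg_of_dpsi _ _ s ((fine (g x) + 1) / w x)) => // n.
    have : (g x < (fine (g x) + 1)%:E)%E.
      by rewrite -[X in (X < _)%E]fineK // lte_fin ltrDl.
    move=> /limn_einf_lt_frequently /(_ n) [k nk]; rewrite lte_fin => H.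
    by exists k => //; rewrite ltr_pdivlMr.
  exists (f x - l).
    have -> : c_ ^~ x = (fun n => f x - a_ n x).
      by apply/funext => n; rewrite /a_ subKr.
    by apply: cvgB => //; exact: cvg_cst.
  rewrite subKr.
  have [] := @cvg_limn_einf_sup _ (fun n => (psi (a_ n x) * w x)%:E) (psi l * w x)%:E => //.
  apply: cvg_EFin; first by apply: nearW.
  apply: cvgM; last exact: cvg_cst.
  by apply: (cvg_comp _ _ lE); exact: continuous_psi.
(* The upper limit is measurable on the whole space and agrees with the limit wherever the latter
   exists. *)
pose p x := fine (limn_esup (fun n => (c_ n x)%:E)).
have mp : measurable_fun setT p.
  apply: measurableT_comp => //; apply: measurable_fun_limn_esup => n.
  exact/measurable_EFinP.
have pE x l : c_ ^~ x @ \oo --> l -> p x = l.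
  move=> cl; rewrite /p.
  have clE : (fun n => (c_ n x)%:E) @ \oo --> l%:E.
    by apply: cvg_EFin => //; exact: nearW.
  by have [_ ->] := cvg_limn_einf_sup clE.
have Cp : C p.
  apply: (closedC Cc) => //; apply: ae_cvg_cvg_prob => //.
  by apply: filterS aec => x [l cl _]; rewrite (pE _ _ cl).
(* J p is the integral of [g], hence at most m. *)
exists p => // c Ccc; apply: le_trans (mJ _ Ccc).
rewrite -lee_fin; apply: le_trans gm.
rewrite /J /Rintegral fineK; last by apply: integrable_fin_num => //; exact: integrable_J.
rewrite le_eqVlt; apply/orP; left; apply/eqP.
apply: ae_eq_integral => //.
  apply/measurable_EFinP; apply: measurable_funM => //.
  by apply: measurable_psi; exact: measurable_funB.
apply: filterS aec => x [l cl gE] _.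
by rewrite gE (pE _ _ cl).
Qed.

(** With p the minimiser and [s] = [dpsi (f - p)], [delta] is the integral of (f - p) s w. It
    remains to show that [delta] is positive and that the integral of (c - p) s w is at most 0 for c
    in C; the latter is obtained by moving from p towards c by steps [t n] tending to 0. *)
Lemma convex_separation : ~ C f -> exists (s : T -> R) (delta : R),
  [/\ measurable_fun setT s, forall x, `|s x| <= 1, 0 < delta &
    forall c, C c ->
      pairing mu c (s \* w) + delta <= pairing mu f (s \* w)].
Proof.
move=> nCf; have [p Cp pmin] := exists_psi_minimizer.
have mp := mC Cp.
pose a x := f x - p x; pose s x := dpsi (a x).
have ma : measurable_fun setT a by exact: measurable_funB.
have ms : measurable_fun setT s by exact: measurable_dpsi.
have s1 x : `|s x| <= 1 by exact: dpsi_le1.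
have isw (g r : T -> R) : measurable_fun setT g -> measurable_fun setT r ->
    (forall x, `|r x| <= 1) -> mu.-integrable setT (EFin \o (g \* w)) ->
    mu.-integrable setT (EFin \o (fun x => g x * (r x * w x))).
  move=> mg mr r1 ig; apply: (@dominated_integrable _ _ _ _ _ (fun x => `|g x * w x|)).
  - by apply: measurable_funM => //; exact: measurable_funM.
  - move=> x; rewrite mulrCA normrM ler_piMl //.
  - exact: integrable_norm ig.
have a0 x : 0 <= a x * (s x * w x).
  have /andP[w0 _] := w01 x; rewrite mulrA mulr_ge0 // /s -{1}(dpsi_psi (a x)).
  by rewrite mulrAC -expr2 mulr_ge0 ?sqr_ge0 ?psi_ge0.
have ipsw := isw _ _ mp ms s1 (Cw Cp).
have ifsw := isw _ _ mf ms s1 fw.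
pose delta := \int[mu]_x (a x * (s x * w x)).
have deltaE : delta = pairing mu f (s \* w) - pairing mu p (s \* w).
  rewrite /pairing -RintegralB //; apply: eq_Rintegral => x _.
  by rewrite -mulrBl.
have iasw : mu.-integrable setT (EFin \o (fun x => a x * (s x * w x))).
  have -> : (fun x => a x * (s x * w x)) = (fun x => f x * (s x * w x) - p x * (s x * w x)).
    by apply/funext => x; rewrite -mulrBl.
  exact: integrable_EFinB.
exists s, delta; split => //.
- rewrite lt_neqAle; apply/andP; split; last by apply: Rintegral_ge0 => x _; exact: a0.
  apply/eqP => delta0; apply: nCf.
  (* If [delta] were 0, the nonnegative integrand would vanish a.e., so f = p a.e.; the constant
     sequence p then converges to f in probability. *)
  apply: (closedC (fs := fun _ => p)) => //; apply: ae_cvg_cvg_prob => //.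
  have := ae_eq_of_integral0 a0 iasw (esym delta0).
  apply: filterS2 wpos => x wx /eqP.
  rewrite /s /dpsi !mulf_eq0 invr_eq0 (gt_eqF wx) (gt_eqF (psi_gt0 _)) !orbF orbb.
  rewrite subr_eq0 => /eqP ->; exact: cvg_cst.
- move=> c Cc; have mc := mC Cc.
  have icsw := isw _ _ mc ms s1 (Cw Cc).
  rewrite deltaE addrCA gerDl -[leRHS]subr0.
  pose u x := c x - p x.
  have mu_ : measurable_fun setT u by exact: measurable_funB.
  have iu : mu.-integrable setT (EFin \o (u \* w)).
    have -> : u \* w = (fun x => c x * w x - p x * w x).
      by apply/funext => x; rewrite -mulrBl.
    by apply: integrable_EFinB; exact: Cw.
  have -> : pairing mu c (s \* w) - pairing mu p (s \* w) = \int[mu]_x (u x * (s x * w x)).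
    rewrite /pairing -RintegralB //; apply: eq_Rintegral => x _.
    by rewrite -mulrBl.
  pose t n : R := n.+1%:R^-1.
  have t01 n : 0 < t n <= 1.
    by rewrite invr_gt0 ltr0n invf_le1 ?ltr0n // ler1n.
  pose r n x := dpsi (a x - t n * u x).
  have mr n : measurable_fun setT (r n).
    by apply: measurable_dpsi; apply: measurable_funB => //; exact: measurable_funM.
  have r1 n x : `|r n x| <= 1 by exact: dpsi_le1.
  have le0 n : \int[mu]_x (u x * (r n x * w x)) <= 0.
    have /andP[t0 t1] := t01 n.
    pose ct x := t n * c x + (1 - t n) * p x.
    have Cct : C ct by apply: (convC Cc Cp); rewrite ltW.
    have ir := isw _ _ mu_ (mr n) (r1 n) iu.
    rewrite -(pmulr_rle0 _ t0) -RintegralZl //.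
    apply: (@le_trans _ _ (J p - J ct)); last by rewrite subr_le0 pmin.
    rewrite /J -RintegralB //; [|exact: integrable_J|exact: integrable_J].
    apply: le_Rintegral => //.
    - exact: integrable_EFinZ.
    - by apply: integrable_EFinB; exact: integrable_J.
    move=> x _; have /andP[w0 _] := w01 x.
    have -> : t n * (u x * (r n x * w x)) = t n * (u x * r n x) * w x by ring.
    rewrite -mulrBl ler_wpM2r //.
    (* The subgradient is taken at [a - t u], which avoids differentiating
       under the integral sign. *)
    have := psi_subgradient (a x) (a x - t n * u x).
    have -> : f x - ct x = a x - t n * u x by rewrite /ct /a /u; ring.
    rewrite -/(r n x) -/(a x); lra.
  (* As [t n] tends to 0, the slopes [r n] tend pointwise to [s], and |u w| dominates. *)
  have cr : (fun n => \int[mu]_x (u x * (r n x * w x))) @ \oo -->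
      \int[mu]_x (u x * (s x * w x)).
    apply: (@Rintegral_dominated_cvg _ _ _ _ _ _ (fun x => `|u x * w x|)).
    - by move=> n; apply: measurable_funM => //; exact: measurable_funM.
    - by apply: measurable_funM => //; exact: measurable_funM.
    - apply: aeW => x; apply: cvgM; first exact: cvg_cst.
      apply: cvgM; last exact: cvg_cst.
      have cu : (fun n => a x - t n * u x) @ \oo --> a x.
        rewrite -[X in _ --> X]subr0 -[X in _ --> _ - X](mul0r (u x)).
        apply: cvgB; first exact: cvg_cst.
        by apply: cvgM; [exact: cvg_harmonic|exact: cvg_cst].
      by apply: (cvg_comp _ _ cu); exact: continuous_dpsi.
    - exact: integrable_norm iu.
    - by apply: aeW => x n; rewrite mulrCA normrM ler_piMl.
  rewrite subr0.
  by apply: (cvgr_to_le cr); exact: nearW.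
Qed.

End separation.

(** * A test function that identifies the limit of a sequence *)

Section test_function.
Context d (T : measurableType d) (R : realType) (mu : probability T R).

(* h is divided by 1 + sup_n |v_n| so that the products v_n h are dominated by a
   constant. *)
Lemma exists_test_function (v_ : nat -> T -> R) (f k w : T -> R) :
  (forall n, measurable_fun setT (v_ n)) ->
  measurable_fun setT f -> measurable_fun setT k ->
  measurable_fun setT w -> (forall x, 0 <= w x <= 1) ->
  {ae mu, forall x, 0 < w x} ->
  {ae mu, forall x, v_ ^~ x @ \oo --> f x} ->
  exists h : T -> R, [/\ measurable_fun setT h, forall x, `|h x| <= w x,
    (fun n => pairing mu (v_ n) h) @ \oo --> pairing mu f h &
    pairing mu k h = pairing mu f h -> aeeq mu k f].
Proof.
move=> mv mf mk mw w01 wpos vf.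
pose S x := esups (fun n => `|v_ n x|%:E) 0%N.
(* Where the supremum is infinite [fine] returns 0, so [h] stays bounded by w everywhere; on the
   convergence set the supremum is finite and [M x] is its true value. *)
pose M x := fine (S x).
have vS n x : (`|v_ n x|%:E <= S x)%E by apply: ereal_sup_ubound; exists n.
have S0 x : (0 <= S x)%E by apply: le_trans (vS 0%N x); rewrite lee_fin.
have M0 x : 0 <= M x by exact: fine_ge0.
have mM : measurable_fun setT M.
  apply: measurableT_comp => //; apply: measurable_fun_esups => n.
  by apply/measurable_EFinP; exact: measurableT_comp.
pose D x := 1 + `|k x| + `|f x|.
have D1 x : 1 <= D x by rewrite /D -addrA lerDl addr_ge0.
have mD : measurable_fun setT D.
  by apply: measurable_funD; [apply: measurable_funD => //|]; exact: measurableT_comp.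
have D0 x : 0 < D x by exact: lt_le_trans (D1 x).
have M1 x : 0 < 1 + M x by rewrite ltr_pwDl.
(* The factor k - f turns the difference of the two pairings into the integral of a weighted square.
   One division by D bounds k - f, the other bounds the function paired with [h], which is k or
   f. *)
pose h x := (k x - f x) / D x / D x * (w x / (1 + M x)).
have minv (g : T -> R) : (forall x, 0 < g x) -> measurable_fun setT g ->
    measurable_fun setT (fun x => (g x)^-1).
  move=> g0 mg.
  have -> : (fun x => (g x)^-1) = (@powR R ^~ (-1)) \o g.
    by apply/funext => x; rewrite /= powR_inv1 // ltW.
  by apply: measurableT_comp => //; exact: measurable_powR.
have mh : measurable_fun setT h.
  apply: measurable_funM; apply: measurable_funM => //; last first.
  - by apply: minv => //; exact: measurable_funD.
  - exact: minv.
  - by apply: measurable_funM; [exact: measurable_funB|exact: minv].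
have q1 x : `|(k x - f x) / D x| <= 1.
  rewrite normrM normfV (gtr0_norm (D0 x)) ler_pdivrMr // mul1r /D -addrA.
  by rewrite (le_trans (ler_normB _ _)) // lerDr.
have wM x : `|w x / (1 + M x)| <= w x.
  have /andP[w0 _] := w01 x.
  rewrite ger0_norm ?divr_ge0 // ?(ltW (M1 x)) // ler_pdivrMr // ler_peMr //.
  by rewrite lerDl.
have Dinv x : `|(D x)^-1| <= 1.
  by rewrite gtr0_norm ?invr_gt0 // invf_le1.
have hw x : `|h x| <= w x.
  rewrite /h normrM (le_trans (ler_piMl _ _)) // normrM.
  by rewrite mulr_ile1.
have bound (g : T -> R) : measurable_fun setT g -> (forall x, `|g x| <= D x) ->
    mu.-integrable setT (EFin \o (fun x => g x * h x)).
  move=> mg gD; apply: (@dominated_integrable _ _ _ _ _ (cst 1)).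
  - exact: measurable_funM.
  - move=> x; have /andP[w0 w1] := w01 x.
    have -> : g x * h x = ((k x - f x) / D x) * ((g x / D x) * (w x / (1 + M x))).
      by rewrite /h; field; rewrite !gt_eqF.
    rewrite normrM mulr_ile1 // normrM mulr_ile1 //; last exact: le_trans (wM x) w1.
    by rewrite normrM normfV (gtr0_norm (D0 x)) ler_pdivrMr // mul1r.
  - exact: finite_measure_integrable_cst.
exists h; split => //.
- apply: (@Rintegral_dominated_cvg _ _ _ _ _ _ (cst 1)).
  + by move=> n; exact: measurable_funM.
  + exact: measurable_funM.
  + by apply: filterS vf => x vx; apply: cvgM => //; exact: cvg_cst.
  + exact: finite_measure_integrable_cst.
  + apply: filterS vf => x vx n; have /andP[w0 w1] := w01 x.
    have Sfin : S x \is a fin_num.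
      have /cvg_seq_bounded/pinfty_ex_gt0[B _ vB] : cvgn (v_ ^~ x).
        by apply/cvg_ex; exists (f x).
      rewrite ge0_fin_numE //; apply: (@le_lt_trans _ _ B%:E); last exact: ltry.
      by apply: ge_ereal_sup => _ [j _ <-]; rewrite lee_fin; exact: vB.
    have vM : `|v_ n x| <= M x by rewrite -lee_fin /M fineK.
    have -> : v_ n x * h x = ((k x - f x) / D x) / D x * (w x * (v_ n x / (1 + M x))).
      by rewrite /h; field; rewrite !gt_eqF.
    rewrite normrM mulr_ile1 // normrM mulr_ile1 //.
      by rewrite ger0_norm.
    rewrite normrM normfV (gtr0_norm (M1 x)) ler_pdivrMr // mul1r.
    by rewrite (le_trans vM) // lerDr.
- move=> kf.
  have ik : mu.-integrable setT (EFin \o (fun x => k x * h x)).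
    by apply: bound => // x; rewrite /D addrAC lerDr addr_ge0.
  have if_ : mu.-integrable setT (EFin \o (fun x => f x * h x)).
    by apply: bound => // x; rewrite /D lerDr addr_ge0.
  have hE x : k x * h x - f x * h x = (k x - f x) ^+ 2 / D x ^+ 2 * (w x / (1 + M x)).
    by rewrite /h; field; rewrite !gt_eqF.
  have : \int[mu]_x (k x * h x - f x * h x) = 0.
    by rewrite RintegralB // -[LHS]/(pairing mu k h - pairing mu f h) kf subrr.
  move=> /ae_eq_of_integral0 -/(_ _ _) H.
  have {}H := H _ (integrable_EFinB ik if_).
  apply: filterS2 wpos (H _) => [x wx|x].
    rewrite hE => E0; apply/eqP; rewrite -subr_eq0; apply: contra_eqT E0 => n0.
    rewrite gt_eqF // mulr_gt0 ?divr_gt0 ?(exprn_gt0 _ (D0 x)) //.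
    by rewrite exprn_even_gt0.
  have /andP[w0 _] := w01 x.
  by rewrite hE mulr_ge0 ?divr_ge0 ?sqr_ge0 // ltW.
Qed.
End test_function.

(** * The space E_K and its scaled unit sets *)

Lemma cvg_prob_scale d (T : measurableType d) (R : realType) (mu : probability T R)
    (fs : nat -> T -> R) (f : T -> R) (l : R) : 0 < l ->
  cvg_prob mu fs f -> cvg_prob mu (fun n x => l * fs n x) (fun x => l * f x).
Proof.
move=> l0 fsf e e0; have := fsf (e / l) (divr_gt0 e0 l0).
apply: cvg_trans; apply: near_eq_cvg; apply: nearW => n; congr (mu _).
apply/seteqP; split => x /=;
  by rewrite -mulrBr normrM (gtr0_norm l0) ler_pdivrMr // mulrC.
Qed.

Section span.
Context d (T : measurableType d) (R : realType) (mu : probability T R).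
Implicit Types (f g h : T -> R) (C : set (T -> R)).

Lemma span0_lincomb C f g (a b : R) :
  span0 mu C f -> span0 mu C g -> span0 mu C (fun x => a * f x + b * g x).
Proof.
move=> [mf [n [c [fs [Cfs fE]]]]] [mg [m [e [gs [Cgs gE]]]]]; split.
  by apply: measurable_funD; exact: measurable_funM.
exists (n + m)%N,
  (fun i : 'I_(n + m) => match fintype.split i with inl j => a * c j | inr j => b * e j end),
  (fun i : 'I_(n + m) => match fintype.split i with inl j => fs j | inr j => gs j end).
split; first by move=> i; case: (fintype.split i).
apply: filterS2 fE gE => x fx gx.
rewrite big_split_ord /= fx gx !mulr_sumr; congr (_ + _).
- by apply: eq_bigr => i _; rewrite (unsplitK (inl i)) mulrA.
- by apply: eq_bigr => i _; rewrite (unsplitK (inr i)) mulrA.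
Qed.

Lemma sub_span0 C : C `<=` L0 T R -> C `<=` span0 mu C.
Proof.
move=> mC f Cf; split; first exact: mC.
exists 1%N, (fun=> 1), (fun=> f); split => //.
by apply: aeW => x; rewrite big_ord1 mul1r.
Qed.

Lemma integrable_aeeq f g : measurable_fun setT g ->
  mu.-integrable setT (EFin \o f) -> aeeq mu f g ->
  mu.-integrable setT (EFin \o g).
Proof.
move=> mg /integrableP[mf fi] fg; apply/integrableP; split.
  exact/measurable_EFinP.
apply: le_lt_trans fi; rewrite le_eqVlt; apply/orP; left; apply/eqP.
apply: ae_eq_integral => //.
- by apply: measurableT_comp => //; exact/measurable_EFinP.
- exact: measurableT_comp.
- by apply: filterS fg => x /= -> _.
Qed.

Lemma integrable_span0 C h : measurable_fun setT h ->
  (forall c, C c -> mu.-integrable setT (EFin \o (fun x => c x * h x))) ->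
  forall f, span0 mu C f -> mu.-integrable setT (EFin \o (fun x => f x * h x)).
Proof.
move=> mh Ch f [mf [n [c [fs [Cfs fE]]]]].
apply: (@integrable_aeeq (fun x => \sum_(i < n) c i * (fs i x * h x))).
- exact: measurable_funM.
- have -> : EFin \o (fun x => \sum_(i < n) c i * (fs i x * h x)) =
    (fun x => \sum_(i < n) (c i * (fs i x * h x))%:E)%E.
    by apply/funext => x /=; rewrite sumEFin.
  by apply: integrable_sum => // i _; apply: integrable_EFinZ; exact: Ch.
- apply: filterS fE => x ->; rewrite mulr_suml.
  by apply: eq_bigr => i _; rewrite mulrA.
Qed.

(** By linearity in each factor it suffices to pair an element of K with one of its polar, where the
    integral is at most 1 by definition. *)
Lemma integrable_EK_EK' K f g : K `<=` L0 T R -> EK mu K f -> EK' mu K g ->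
  mu.-integrable setT (EFin \o (fun x => f x * g x)).
Proof.
move=> mK Kf K'g; have mg : measurable_fun setT g by case: K'g.
apply: (integrable_span0 mg _ Kf) => k Kk.
have -> : (fun x => k x * g x) = (fun x => g x * k x).
  by apply/funext => x; rewrite mulrC.
have mk := mK _ Kk.
apply: (integrable_span0 mk _ K'g) => p [mp pK].
apply/integrableP; split; first by apply/measurable_EFinP; exact: measurable_funM.
apply: le_lt_trans (ltry 1); apply: le_trans (pK k Kk).
by rewrite le_eqVlt; apply/orP; left; apply/eqP; apply: eq_integral => x _; rewrite /= mulrC.
Qed.

End span.

Section scaled_sets.
Context d (T : measurableType d) (R : realType) (mu : probability T R).
Variable K : set (T -> R).
Hypotheses (K0 : L0set mu K) (acK : absolutely_convex K).
Implicit Types (f g : T -> R).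

Let mK : K `<=` L0 T R. Proof. by case: K0. Qed.

Lemma scaleset_mono (e l : R) : 0 < e <= l -> scaleset e K `<=` scaleset l K.
Proof.
move=> /andP[e0 el] _ [k Kk <-]; have l0 : 0 < l := lt_le_trans e0 el.
(* [absolutely_convex] speaks of two terms, so a single multiple is written with a second
   coefficient 0. *)
exists (fun x => e / l * k x + 0 * k x).
  apply: acK => //; rewrite normr0 addr0 ger0_norm ?(divr_ge0 (ltW e0) (ltW l0)) //.
  by rewrite ler_pdivrMr // mul1r.
by apply/funext => x; rewrite mul0r addr0 mulrA mulrCA divff ?mulr1 // gt_eqF.
Qed.

Lemma scalesetE (l : R) f : 0 < l ->
  scaleset l K f <-> K (fun x => l^-1 * f x).
Proof.
move=> l0; split => [[k Kk <-]|Kf].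
  have -> // : (fun x => l^-1 * (l * k x)) = k.
  by apply/funext => x; rewrite mulKf // gt_eqF.
by exists (fun x => l^-1 * f x) => //; apply/funext => x; rewrite mulVKf // gt_eqF.
Qed.

Lemma scaleset_sub_EK (l : R) : scaleset l K `<=` EK mu K.
Proof.
move=> _ [k Kk <-]; have Ek := sub_span0 mu mK Kk.
have -> : (fun x => l * k x) = (fun x => l * k x + 0 * k x).
  by apply/funext => x; rewrite mul0r addr0.
exact: span0_lincomb.
Qed.

Lemma scaleset_aeeq (l : R) f g : 0 < l -> scaleset l K f ->
  measurable_fun setT g -> aeeq mu f g -> scaleset l K g.
Proof.
move=> l0 /(scalesetE _ l0) Kf mg fg; apply/(scalesetE _ l0).
have [_ satK] := K0; apply: satK Kf _ _; first exact: measurable_funM.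
by apply: filterS fg => x ->.
Qed.

Lemma scaleset_convex (l : R) : Defs.convex_set (scaleset l K).
Proof.
move=> _ _ t [k Kk <-] [k' Kk' <-] /andP[t0 t1].
exists (fun x => t * k x + (1 - t) * k' x).
  by apply: acK => //; rewrite !ger0_norm ?subr_ge0 // subrKC.
by apply/funext => x; ring.
Qed.

Lemma scaleset_closed_in_prob (l : R) : closed_in_prob mu K -> 0 < l ->
  closed_in_prob mu (scaleset l K).
Proof.
move=> cK l0 fs f fsK mf fsf; apply/(scalesetE _ l0).
apply: (cK (fun n x => l^-1 * fs n x)).
- by move=> n; apply/(scalesetE _ l0).
- exact: measurable_funM.
- by apply: cvg_prob_scale => //; rewrite invr_gt0.
Qed.

(** Induction on n: s k + c f = S ((s / S) k + (c / S) f) with S = s + |c|, and the new coefficients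
    have absolute values summing to at most 1. *)
Lemma absolutely_convex_sum n (c : 'I_n -> R) (fs : 'I_n -> T -> R) :
  K !=set0 -> (forall i, K (fs i)) -> exists2 k, K k &
    forall x, \sum_(i < n) c i * fs i x = (\sum_(i < n) `|c i|) * k x.
Proof.
move=> [k0 Kk0]; elim: n c fs => [|n IH] c fs Kfs.
  by exists k0 => // x; rewrite !big_ord0 mul0r.
have [//|k Kk kE] := IH (fun i => c (widen_ord (leqnSn n) i))
  (fun i => fs (widen_ord (leqnSn n) i)).
set s := \sum_(i < n) `|_| in kE.
have s0 : 0 <= s by apply: sumr_ge0.
pose S := s + `|c ord_max|.
have S0 : 0 <= S by rewrite addr_ge0.
exists (fun x => s / S * k x + c ord_max / S * fs ord_max x).
  apply: acK => //; rewrite !normrM !normfV (ger0_norm s0) (ger0_norm S0) -mulrDl -/S.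
  (* If S = 0, the quotient S / S is 0 by convention and the bound still holds; in the identity
     below, all coefficients then vanish. *)
  have [->|Sn0] := eqVneq S 0; first by rewrite mul0r.
  by rewrite divff.
move=> x; rewrite !big_ord_recr /= kE -/s -/S.
have [S00|Sn0] := eqVneq S 0; last by field.
have s00 : s = 0 by apply/eqP; rewrite eq_le s0 andbT -S00 lerDl.
have -> : c ord_max = 0.
  by apply/eqP; rewrite -normr_eq0; move/eqP: S00; rewrite /S s00 add0r.
by rewrite S00 s00 !mul0r addr0.
Qed.

(** This allows one multiple of K to contain both a given point of E_K and a given K-bounded set. *)
Lemma EK_absorbed f : K !=set0 -> EK mu K f ->
  exists S : R, forall l, 0 < l -> S <= l -> scaleset l K f.
Proof.
move=> Kn0 [mf [n [c [fs [Kfs fE]]]]].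
have [k Kk kE] := absolutely_convex_sum c Kn0 Kfs.
set S := \sum_(i < n) _ in kE.
have S0 : 0 <= S by apply: sumr_ge0.
exists S => l l0 Sl; apply: (@scaleset_aeeq _ (fun x => S * k x)) => //; last first.
  by apply: filterS fE => x ->; rewrite kE.
apply/(scalesetE _ l0).
have -> : (fun x => l^-1 * (S * k x)) = (fun x => S / l * k x + 0 * k x).
  by apply/funext => x; rewrite mul0r addr0 mulrA (mulrC S).
apply: acK => //; rewrite normr0 addr0 ger0_norm ?divr_ge0 ?(ltW l0) //.
by rewrite ler_pdivrMr // mul1r.
Qed.

End scaled_sets.

(** * Equicontinuous Koethe topologies *)

Section equicontinuous_Kothe.
Context d (T : measurableType d) (R : realType) (mu : probability T R).
Variables (K F : set (T -> R)) (tau : set (set (T -> R))).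
Hypotheses (K0 : L0set mu K) (acK : absolutely_convex K)
  (topo : is_topology_on mu (EK mu K) tau)
  (compK : compact_in tau K) (Ftau : induces_top mu K F tau).
Implicit Types (f g h : T -> R) (C V U : set (T -> R)).

Let mK : K `<=` L0 T R. Proof. by case: K0. Qed.
Let FE : F `<=` EK' mu K. Proof. by case: Ftau. Qed.
Let solidF : Defs.solid mu F. Proof. by case: Ftau. Qed.

(** Truncating |g| at 1 stays in F by solidity, and a bounded weight is integrable for a
    probability. *)
Lemma exists_weight : exists w : T -> R, [/\ F w, measurable_fun setT w,
  forall x, 0 <= w x <= 1 & {ae mu, forall x, 0 < w x}].
Proof.
have [_ _ _ [g [Fg gpos]] _] := Ftau.
have [mg _] := FE Fg.
pose w x := Num.min `|g x| 1.
have mw : measurable_fun setT w.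
  by apply: measurable_minr => //; exact: measurableT_comp.
have w01 x : 0 <= w x <= 1 by rewrite /w le_min ge_min normr_ge0 ler01 lexx orbT.
exists w; split => //.
- apply: solidF Fg mw _; apply: aeW => x.
  by rewrite ger0_norm; [rewrite /w ge_min lexx|have /andP[] := w01 x].
- by apply: filterS gpos => x gx; rewrite /w lt_min ltr01 andbT normr_gt0 gt_eqF.
Qed.

Lemma weak_top_slab g (r e : R) : F g ->
  weak_top mu K F [set h | EK mu K h /\ `|pairing mu h g - r| < e].
Proof.
move=> Fg; split; first by move=> h [].
move=> f [Ef fe]; exists 1%N, (fun=> g), (e - `|pairing mu f g - r|); split => //.
split; first by rewrite subr_gt0.
move=> h [Eh /(_ ord0) hf]; split => //.
rewrite -(subrK (pairing mu f g) (pairing mu h g)) -addrA.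
by apply: le_lt_trans (ler_normD _ _) _; rewrite -ltrBrDr.
Qed.

(** Multiplication by l is weakly continuous. This pulls neighbourhoods in lK back to K, the set on
    which compactness is given. *)
Lemma weak_top_scale V (l : R) : 0 < l -> weak_top mu K F V ->
  weak_top mu K F [set h | EK mu K h /\ V (fun x => l * h x)].
Proof.
move=> l0 [VE openV]; split; first by move=> h [].
have pairingZ h g : EK mu K h -> F g ->
    pairing mu (fun x => l * h x) g = l * pairing mu h g.
  move=> Eh Fg; rewrite /pairing -RintegralZl //.
    by apply: eq_Rintegral => x _; rewrite mulrA.
  by apply: integrable_EK_EK' Eh _ => //; exact: FE.
have EZ h : EK mu K h -> EK mu K (fun x => l * h x).
  move=> Eh; have := span0_lincomb l 0 Eh Eh.
  by have -> : (fun x => l * h x + 0 * h x) = (fun x => l * h x)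
    by apply/funext => x; rewrite mul0r addr0.
move=> f [Ef /openV [n [gs [e [Fgs [e0 sub]]]]]].
exists n, gs, (e / l); split => //; split; first by rewrite divr_gt0.
move=> h [Eh hf]; split => //; apply: sub; split; first exact: EZ.
move=> i; rewrite !pairingZ // -mulrBr normrM (gtr0_norm l0) mulrC.
by rewrite -ltr_pdivlMr.
Qed.

(** The topologies are compared only on K-bounded sets, so open sets are exchanged through their
    traces on lK. *)
Lemma tau_trace_of_weak (l : R) V : 0 < l -> weak_top mu K F V ->
  exists2 U, tau U & U `&` scaleset l K = V `&` scaleset l K.
Proof.
move=> l0 wV; have [_ _ _ _ traceE] := Ftau.
have : trace_top (weak_top mu K F) (scaleset l K) (V `&` scaleset l K).
  by exists V.
rewrite -traceE; first by move=> [U tU UE]; exists U.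
by exists l; split.
Qed.

Lemma weak_trace_of_tau (l : R) U : 0 < l -> tau U ->
  exists2 V, weak_top mu K F V & V `&` scaleset l K = U `&` scaleset l K.
Proof.
move=> l0 tU; have [_ _ _ _ traceE] := Ftau.
have : trace_top tau (scaleset l K) (U `&` scaleset l K) by exists U.
rewrite traceE; first by move=> [V wV VE]; exists V.
by exists l; split.
Qed.

Let K1 : scaleset 1 K = K.
Proof.
apply/seteqP; split => [_ [k Kk <-]|k Kk].
  by have -> : (fun x => 1 * k x) = k by apply/funext => x; rewrite mul1r.
by exists k => //; apply/funext => x; rewrite mul1r.
Qed.

(** Each f outside C is separated from C by a weak slab of radius [delta]. It becomes a
    tau-neighbourhood with the same trace on some lK; since lK contains both f and C, this
    neighbourhood misses C. *)
Lemma tau_closed_of_closed_in_prob C (e : R) : 0 < e ->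
  C `<=` scaleset e K -> Defs.convex_set C -> closed_in_prob mu C ->
  tau_closed (EK mu K) tau C.
Proof.
move=> e0 CK convC closedC.
have [tauE [tE t0] tauU _ _] := topo.
have CE : C `<=` EK mu K by move=> c /CK; exact: scaleset_sub_EK.
split => //.
have [C0|C0] := pselect (C !=set0); last first.
  have -> : C = set0 by apply/seteqP; split => // c Cc; case: C0; exists c.
  by rewrite setD0.
have Kn0 : K !=set0 by have [c /CK [k Kk _]] := C0; exists k.
have [w [Fw mw w01 wpos]] := exists_weight.
have iw f : EK mu K f -> mu.-integrable setT (EFin \o (f \* w)).
  by move=> Ef; apply: integrable_EK_EK' Ef _ => //; exact: FE.
have sepf f : (EK mu K `\` C) f -> exists U, [/\ tau U, U f & U `&` C = set0].
  move=> [Ef nCf]; have mf : measurable_fun setT f by case: Ef.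
  have [s [delta [ms s1 delta0 sepC]]] := convex_separation mw w01 wpos mf (iw f Ef)
    (fun c Cc => proj1 (CE c Cc)) convC closedC (fun c Cc => iw c (CE c Cc)) C0 nCf.
  have Fsw : F (s \* w).
    apply: solidF Fw _ _; first exact: measurable_funM.
    by apply: aeW => x; rewrite normrM ler_piMl.
  have [S absS] := EK_absorbed K0 acK Kn0 Ef.
  pose l := Num.max e S.
  have l0 : 0 < l by rewrite lt_max e0.
  have [U tU UE] := tau_trace_of_weak l0 (weak_top_slab (pairing mu f (s \* w)) delta Fsw).
  have Kf : scaleset l K f by apply: absS => //; rewrite le_max lexx orbT.
  exists U; split => //.
    have : (U `&` scaleset l K) f by rewrite UE; split => //; split => //; rewrite subrr normr0.
    by case.
  apply/seteqP; split => // c [Uc Cc].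
  have : (U `&` scaleset l K) c.
    by split => //; apply: scaleset_mono (CK _ Cc) => //; rewrite e0 le_max lexx.
  rewrite UE => -[[_]] + _; apply/negP; rewrite -leNgt distrC.
  by apply: le_trans (ler_norm _); have := sepC c Cc; lra.
(* Moving the hypothesis under the existential makes the statement total in f, as [choice]
   requires. *)
have sepf' f : exists U, (EK mu K `\` C) f -> [/\ tau U, U f & U `&` C = set0].
  have [ECf|nECf] := pselect ((EK mu K `\` C) f); last by exists set0.
  by have [U HU] := sepf f ECf; exists U.
have [U_ U_P] := choice sepf'.
have -> : EK mu K `\` C = \bigcup_(i : {f | (EK mu K `\` C) f}) U_ (sval i).
  apply/seteqP; split => [f ECf|f [[g ECg] _ /= Uf]].
    by exists (exist _ f ECf) => //=; have [] := U_P f ECf.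
  have [tU _ UC] := U_P g ECg; split; first exact: tauE tU _ Uf.
  by move=> Cf; have : (U_ g `&` C) f by []; rewrite UC.
by apply: tauU => -[g ECg] /=; have [] := U_P g ECg.
Qed.

(** After division by l the sequence lies in the compact set K and has a cluster point, which is
    shown to equal f / l a.e. A single index suffices, because U will be the complement of a closed
    set containing all [v_ n]. *)
Lemma tau_nbhs_ae_cvg (l : R) (v_ : nat -> T -> R) f U : 0 < l ->
  (forall n, scaleset l K (v_ n)) -> EK mu K f ->
  {ae mu, forall x, v_ ^~ x @ \oo --> f x} -> tau U -> U f ->
  exists n, U (v_ n).
Proof.
move=> l0 Kv Ef vf tU Uf.
have [tauE _ _ _ tausat] := topo.
pose k_ n x := l^-1 * v_ n x.
have Kk_ n : K (k_ n) by apply/(scalesetE _ _ l0).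
have vE n : v_ n = (fun x => l * k_ n x).
  by apply/funext => x; rewrite mulVKf // gt_eqF.
(* Otherwise each point of K has an open neighbourhood that the sequence leaves for good from some
   index on. Finitely many cover K, and at the largest of these indices [k_ N] would lie in none. *)
have [k Kk kcluster] : exists2 k, K k & forall W, tau W -> W k ->
    forall N, exists2 n, (N <= n)%N & W (k_ n).
  apply: contrapT => nok.
  have escape (i : {k | K k}) : exists WN : set (T -> R) * nat,
      [/\ tau WN.1, WN.1 (sval i) & forall n, (WN.2 <= n)%N -> ~ WN.1 (k_ n)].
    case: i => k Kk /=; apply: contrapT => nW; apply: nok; exists k => // W tW Wk N.
    apply: contrapT => nn; apply: nW; exists (W, N); split => //= n Nn Wn.
    by apply: nn; exists n.
  have {escape}[WN WNP] := choice escape.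
  have [||J [finJ KJ]] := compK (U := fun i => (WN i).1).
  - by move=> i; have [] := WNP i.
  - by move=> k Kk; exists (exist _ k Kk) => //; have [] := WNP (exist _ k Kk).
  have [N NJ] : exists N, forall i, J i -> ((WN i).2 <= N)%N.
    have /finite_seqP[r rE] := finite_image (fun i => (WN i).2) finJ.
    exists (\max_(m <- r) m)%N => i Ji; apply: (@leq_bigmax_seq _ r xpredT id) => //.
    by have : [set (WN i).2 | i in J] (WN i).2 by [exists i]; rewrite rE.
  have [i Ji Wi] := KJ _ (Kk_ N).
  by have [_ _ /(_ _ (NJ i Ji))] := WNP i.
have mk : measurable_fun setT k by exact: mK.
have mf : measurable_fun setT f by case: Ef.
have [w [Fw mw w01 wpos]] := exists_weight.
have kf : aeeq mu k (fun x => l^-1 * f x).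
  have [h [mh hw hcvg]] := exists_test_function (v_ := k_) (fun n => mK (Kk_ n))
     (measurable_funM (@measurable_cst _ _ _ _ setT l^-1) mf) mk mw w01 wpos 
     (filterS (fun x vx => cvgM (cvg_cst _) vx) vf).
  apply; apply: contrapT => /eqP; rewrite -subr_eq0 -normr_gt0.
  set D := `|_| => D0.
  have Fh : F h.
    apply: solidF Fw mh _; apply: aeW => x.
    by rewrite (le_trans (hw x)) // ler_norm.
  (* If the pairings of k and f / l with [h] differ by D > 0, some late [k_ n] pairs within D / 2 of
     both, which is impossible. *)
  have D2 : 0 < D / 2 by rewrite divr_gt0.
  have [W tW WE] := tau_trace_of_weak ltr01 (weak_top_slab (pairing mu k h) (D / 2) Fh).
  have Wk : W k.
    have : (W `&` scaleset 1 K) k.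
      rewrite WE K1; split => //; split; last by rewrite subrr normr0.
      exact: (sub_span0 mu mK).
    by case.
  move/cvgrPdist_lt: hcvg => /(_ _ D2) [N _ HN].
  have [n Nn Wn] := kcluster W tW Wk N.
  have : (W `&` scaleset 1 K) (k_ n) by rewrite K1.
  rewrite WE => -[[_ kn] _]; have fn := HN n Nn.
  have : D < D / 2 + D / 2.
    apply: le_lt_trans (ltrD fn kn); apply: le_trans _ (ler_normD _ _).
    by rewrite subrKA distrC.
  by rewrite -splitr ltxx.
(* U is replaced by a weakly open V on lK, V is rescaled to K, and the result is turned into a
   tau-open W around k. Compatibility with a.e. equality allows U f to be read as U (l k). *)
have [V wV VE] := weak_trace_of_tau l0 tU.
have lkE : EK mu K (fun x => l * k x).
  by apply: (scaleset_sub_EK K0); exists k.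
have Vlk : V (fun x => l * k x).
  have : (V `&` scaleset l K) (fun x => l * k x).
    rewrite VE; split; last by exists k.
    apply: tausat tU Uf lkE _; apply: filterS kf => x ->.
    by rewrite mulVKf // gt_eqF.
  by case.
have [W tW WE] := tau_trace_of_weak ltr01 (weak_top_scale l0 wV).
have Wk : W k.
  have : (W `&` scaleset 1 K) k.
    rewrite WE K1; split => //; split => //.
    exact: (sub_span0 mu mK).
  by case.
have [n _ Wn] := kcluster W tW Wk 0%N.
exists n.
have : (W `&` scaleset 1 K) (k_ n) by rewrite K1.
rewrite WE => -[[_ Vn] _].
have : (V `&` scaleset l K) (v_ n) by split => //; rewrite vE.
by rewrite VE => -[].
Qed.

End equicontinuous_Kothe.

(** * Sublevel sets and the equivalences *)

Lemma ereal_real_between (R : realType) (x y : \bar R) : (x < y)%E ->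
  exists r : R, (x < r%:E)%E /\ (r%:E < y)%E.
Proof.
case: x y => [x| |] [y| |] //.
- by rewrite lte_fin => xy; exists ((x + y) / 2); rewrite !lte_fin !midf_lt.
- by move=> _; exists (x + 1); rewrite lte_fin ltrDl ltr01 ltry.
- by move=> _; exists (y - 1); rewrite lte_fin ltrBlDr ltrDl ltr01 ltNyr.
- by move=> _; exists 0; rewrite ltNyr ltry.
Qed.

Section sublevels.
Context d (T : measurableType d) (R : realType) (mu : probability T R).
Variables (K : set (T -> R)) (phi : (T -> R) -> \bar R).
Hypotheses (K0 : L0set mu K) (acK : absolutely_convex K)
  (cK : closed_in_prob mu K) (phiP : convex_proper mu (EK mu K) phi).

Lemma convex_EK : Defs.convex_set (EK mu K).
Proof. by move=> f g t Ef Eg _; exact: span0_lincomb. Qed.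

Lemma sublevel_convex (l : R) : Defs.convex_set (sublevel (EK mu K) phi l).
Proof.
have [_ _ _ phiconv] := phiP.
move=> f g t [Ef fl] [Eg gl] t01; split; first exact: convex_EK.
have /andP[t0 t1] := t01.
apply: (le_trans (phiconv f g t Ef Eg t01)).
apply: (@le_trans _ _ (t%:E * l%:E + (1 - t)%:E * l%:E)%E).
  by apply: leeD; apply: lee_wpmul2l => //; rewrite lee_fin ?subr_ge0.
by rewrite -!EFinM -EFinD lee_fin -mulrDl subrKC mul1r.
Qed.

Lemma sublevel_L0set (l : R) : L0set mu (sublevel (EK mu K) phi l).
Proof.
have [phiae _ _ _] := phiP.
split; first by move=> f [[]].
move=> f g [Ef fl] mg fg.
have Eg : EK mu K g.
  have [_ [n [c [fs [Kfs fE]]]]] := Ef; split => //.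
  exists n, c, fs; split => //.
  by apply: filterS2 fg fE => x <-.
by split => //; rewrite -(phiae f g).
Qed.

Lemma sublevel_closed_in_prob (l e : R) : 0 < e ->
  equicontinuous_Fatou mu K phi ->
  closed_in_prob mu (sublevel (EK mu K) phi l `&` scaleset e K).
Proof.
move=> e0 fatou fs f fsC mf fsf.
have Kf : scaleset e K f.
  have closedKe := scaleset_closed_in_prob cK e0.
  by apply: closedKe _ mf fsf => n; have [] := fsC n.
have Ef := scaleset_sub_EK K0 Kf.
split => //; split => //.
apply: le_trans (fatou fs f _ Ef fsf) _.
  by exists e; split => // _ [n _ <-]; have [] := fsC n.
rewrite leNgt; apply/negP => llt.
have : (limn_einf (fun n => phi (fs n)) <= l%:E)%E; last by rewrite leNgt llt.
rewrite limn_einf_lim; apply: lime_le; first exact: is_cvg_einfs.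
apply: nearW => n; apply: le_trans (ereal_inf_lbound _) _; first by exists n => /=.
by have [[]] := fsC n.
Qed.

End sublevels.

Theorem theorem4p7 (d : measure_display) (T : measurableType d) (R : realType)
  (mu : probability T R) (K : set (T -> R)) (phi : (T -> R) -> \bar R) :
  measure_is_complete mu ->
  L0set mu K -> absolutely_convex K -> closed_in_prob mu K ->
  bounded_in_prob mu K ->
  convex_proper mu (EK mu K) phi ->
  forall tau : set (set (T -> R)), equicontinuous_Kothe mu K tau ->
    ((forall (l e : R), 0 < e ->
        tau_closed (EK mu K) tau (sublevel (EK mu K) phi l `&` scaleset e K))
      <-> equicontinuous_Fatou mu K phi) /\
    (Krein_Smulian mu K tau ->
      ((forall (l e : R), 0 < e ->
          tau_closed (EK mu K) tau (sublevel (EK mu K) phi l `&` scaleset e K))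
        <-> lsc_on (EK mu K) tau phi)).
Proof.
move=> _ K0 acK cK _ phiP tau [topo compK [F Ftau]].
split; [split|move=> KS].
- move=> closedS fs f [l [l0 fsK]] Ef fsf; rewrite leNgt; apply/negP => ltphi.
  have Kfs n : scaleset l K (fs n) by apply: fsK; exists n.
  have [r [liminf_r r_phi]] := ereal_real_between ltphi.
  have mfs n : measurable_fun setT (fs n).
    by have [] := scaleset_sub_EK K0 (Kfs n).
  have mf : measurable_fun setT f by case: Ef.
  (* The chosen terms all satisfy phi < r < phi f: they lie in a closed sublevel piece whose
     complement is a neighbourhood of f. *)
  have [k [phik fsk]] := cvg_prob_fast_subseq (P := fun g => (phi g < r%:E)%E) mfs mf fsf
    (limn_einf_lt_frequently liminf_r).
  have [_ tauC] := closedS r l l0.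
  have nSf : (EK mu K `\` (sublevel (EK mu K) phi r `&` scaleset l K)) f.
    by split => // -[[_]] + _; rewrite leNgt r_phi.
  have [n [_]] := tau_nbhs_ae_cvg K0 topo compK Ftau l0 (fun n => Kfs (k n)) Ef fsk tauC nSf.
  apply; split; last exact: Kfs.
  by split; [exact: scaleset_sub_EK K0 _ _ (Kfs (k n))|exact/ltW/phik].
- move=> fatou l e e0; apply: (tau_closed_of_closed_in_prob K0 acK topo Ftau e0).
  + by move=> f [].
  + move=> f g t [Sf Kf] [Sg Kg] t01; split; first exact: sublevel_convex.
    exact: scaleset_convex.
  + exact: sublevel_closed_in_prob.
have [tauE _ tauU _ _] := topo.
have SE l : sublevel (EK mu K) phi l `<=` EK mu K by move=> f [].
have KSl l := KS _ (SE l) (sublevel_L0set phiP l) (sublevel_convex phiP (l:=l)).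
have compl l : EK mu K `\` sublevel (EK mu K) phi l = [set f | EK mu K f /\ (l%:E < phi f)%E].
  apply/seteqP; split => f [Ef] /=.
    by move=> nS; split => //; rewrite ltNge; apply/negP => le; apply: nS.
  by move=> lt; split => // -[_]; rewrite leNgt lt.
split => [closedS f r Ef rf|lsc l e e0].
(* The closed pieces make the whole sublevel set closed, and its complement is the required
   neighbourhood. *)
- have [_ tauS] := (KSl r).2 (fun e e0 => closedS r e e0).
  rewrite compl in tauS.
  by exists [set f | EK mu K f /\ (r%:E < phi f)%E]; split => // h [].
(* Conversely, the strict superlevel set is the union of the neighbourhoods given by lower
   semicontinuity, hence open. *)
- apply: (KSl l).1 e0; split => //; rewrite compl.
  have sepf f : exists U, EK mu K f /\ (l%:E < phi f)%E ->
      [/\ tau U, U f & forall h, U h -> (l%:E < phi h)%E].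
    have [[Ef lf]|nf] := pselect (EK mu K f /\ (l%:E < phi f)%E); last by exists set0.
    by have [U HU] := lsc f l Ef lf; exists U.
  have [U_ U_P] := choice sepf.
  have -> : [set f | EK mu K f /\ (l%:E < phi f)%E] =
      \bigcup_(i : {f | EK mu K f /\ (l%:E < phi f)%E}) U_ (sval i).
    apply/seteqP; split => [f Sf|f [[g Sg] _ /= Uf]].
      by exists (exist _ f Sf) => //=; have [] := U_P f Sf.
    have [tU _ Uphi] := U_P g Sg; split; [exact: tauE tU _ Uf|exact: Uphi].
  by apply: tauU => -[g Sg] /=; have [] := U_P g Sg.
Qed.
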